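(* Let $H$ be a complex Hilbert space, let $A\in B(H)$ be a non-zero positive semidefinite operator with closed range $R(A)$, and let $T\in B_A(H)$ be $A$-normal. Then $\sigma_A(T)=\sigma_{A_{app}}(T)$.
   Context: $B(H)$ is the algebra of bounded linear operators on $H$; $R(\cdot)$ denotes range. $\|x\|_A=\langle Ax,x\rangle^{1/2}$. $B_A(H)=\{T\in B(H): R(T^*A)\subset R(A)\}$. For $T\in B_A(H)$, $T^{\sharp}\in B(H)$ is the unique operator with $T^*A=AT^{\sharp}$ and $R(T^{\sharp})\subset\overline{R(A)}$. An operator $T\in B_A(H)$ is $A$-normal if $\|Tx\|_A=\|T^{\sharp}x\|_A$ for all $x\in H$. $B_{A^{1/2}}(H)=\{T\in B(H): R(T^*A^{1/2})\subset R(A^{1/2})\}$; equivalently, there is $d>0$ with $\|Tx\|_A\le d\|x\|_A$ for all $x\in H$. One has $B_A(H)\subset B_{A^{1/2}}(H)$. A non-zero $T\in B_{A^{1/2}}(H)$ is $A$-invertible in $B_{A^{1/2}}(H)$ if there is a non-zero $S\in B_{A^{1/2}}(H)$ with $ATS=AST=A$. For $T\in B_{A^{1/2}}(H)$, $\rho_A(T)=\{\lambda\in\mathbb C:\lambda-T\text{ is }A\text{-invertible in }B_{A^{1/2}}(H)\}$ and $\sigma_A(T)=\mathbb C\setminus\rho_A(T)$. $\sigma_{A_{app}}(T)$ is the set of $\lambda\in\mathbb C$ for which there is a sequence $\{x_n\}$ in $H$ with $\|x_n\|_A=1$ for all $n$ and $\|(T-\lambda)x_n\|_A\to0$. *)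

(* Defs.v *)
From HB Require Import structures.
From mathcomp Require Import all_boot all_order all_algebra.
From mathcomp Require Import sesquilinear complex.
From mathcomp Require Import all_classical all_reals all_analysis.

Set Implicit Arguments.
Unset Strict Implicit.
Unset Printing Implicit Defensive.
Import Order.TTheory GRing.Theory Num.Theory.
Import numFieldNormedType.Exports.
Local Open Scope classical_set_scope.
Local Open Scope complex_scope.
Local Open Scope ring_scope.

Section SemiHilbert.
Variables (R : realType) (H : completeNormedModType R[i]).
Variable dot : {dot H for Num.conj}.

(* A complex Hilbert space is a complete normed space over R[i] together with an
   inner product (linear in its first argument) inducing the norm. *)
Definition hilbert_norm := forall x : H, `|x| ^+ 2 = dot x x.

Definition bounded_op : set (H -> H) :=
  [set T | linear T /\ continuous T].

(* The order on R[i] makes 0 <= z mean that z is real and nonnegative. *)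
Definition positive_op : set (H -> H) :=
  [set T | bounded_op T /\ forall x, 0 <= dot (T x) x].

(* The adjoint of a bounded operator, the square root of a positive one, and the
   operator T^sharp are unique; each is given by its defining relation, and
   "P holds of it" is written as "some operator in that relation satisfies P". *)
Definition is_adjoint (T Ts : H -> H) :=
  bounded_op Ts /\ forall x y, dot (T x) y = dot x (Ts y).

Definition is_sqrt (A B : H -> H) := positive_op B /\ B \o B = A.

Variable A : H -> H.

(* For A >= 0 the number <Ax, x> is real, so taking Re loses nothing. *)
Definition Anorm (x : H) : R := Num.sqrt (complex.Re (dot (A x) x)).

Definition B_A : set (H -> H) :=
  [set T | bounded_op T /\
     exists2 Ts, is_adjoint T Ts & range (Ts \o A) `<=` range A].

Definition is_sharp (T S : H -> H) :=
  [/\ bounded_op S,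
      exists2 Ts, is_adjoint T Ts & Ts \o A = A \o S &
      range S `<=` closure (range A)].

Definition A_normal (T : H -> H) :=
  exists2 S, is_sharp T S & forall x, Anorm (T x) = Anorm (S x).

Definition B_Asqrt : set (H -> H) :=
  [set T | bounded_op T /\
     exists2 B, is_sqrt A B &
     exists2 Ts, is_adjoint T Ts & range (Ts \o B) `<=` range B].

Definition A_invertible (T : H -> H) :=
  [/\ B_Asqrt T, T <> (fun=> 0) &
      exists S, [/\ B_Asqrt S, S <> (fun=> 0),
                    A \o T \o S = A & A \o S \o T = A]].

Definition rho_A (T : H -> H) : set R[i] :=
  [set lam | A_invertible (fun x => lam *: x - T x)].

Definition sigma_A (T : H -> H) : set R[i] := ~` rho_A T.

Definition sigma_A_app (T : H -> H) : set R[i] :=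
  [set lam | exists x : nat -> H,
     (forall n, Anorm (x n) = 1) /\
     (fun n => Anorm (T (x n) - lam *: x n)) @ \oo --> (0 : R)].

End SemiHilbert.

(* Main.v *)
Require Import Defs.
From HB Require Import structures.
From mathcomp Require Import all_boot all_order all_algebra.
From mathcomp Require Import sesquilinear complex.
From mathcomp Require Import all_classical all_reals all_analysis.
From mathcomp Require Import ring lra.
Import Order.TTheory GRing.Theory Num.Theory.
Import numFieldNormedType.Exports.
Set Implicit Arguments.
Unset Strict Implicit.
Unset Printing Implicit Defensive.
Local Open Scope classical_set_scope.
Local Open Scope complex_scope.
Local Open Scope ring_scope.

(* Let P be the orthogonal projection on R(A). As R(A) is closed,
   <A x, x> >= a |P x|^2 for some a > 0, so |.|_A is a Hilbert norm on R(A), on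
   which T^# induces the adjoint of the operator induced by T; the latter is
   therefore normal. Put M = lam - T and N = conj lam - T^#, so that
   |M x|_A = |N x|_A. If lam is not an approximate eigenvalue then
   |M x|_A >= c |x|_A, hence Q = M^* A M + (1 - P) is coercive and
   S = Q^-1 M^* A is a left inverse of M modulo ker A. It is also a right
   inverse, since A N (M S - 1) = 0 and N is bounded below as M is.
   Membership in B_{A^{1/2}}(H) requires an actual square root of A; on R(A) the
   operator A is bounded below, so that the usual fixed-point iteration
   converges geometrically. *)

(** * Real-valued norm and inner product *)

Section Hilbert.
Variables (R : realType) (H : completeNormedModType R[i]).
Variable dot : {dot H for Num.conj}.
Hypothesis hdot : hilbert_norm dot.
Implicit Types (x y z : H) (f : H -> H).

(** The norm of [H] takes values in [R[i]]. Its real part lives in the ordered field [R], where all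
    estimates below are made. *)
Definition nrm (x : H) : R := complex.Re `|x|.
Definition rdot x y : R := complex.Re (dot x y).

Lemma normE x : `|x| = (nrm x)%:C.
Proof. by rewrite /nrm RRe_real// normr_real. Qed.

Lemma nrm_ge0 x : 0 <= nrm x.
Proof. by rewrite -ler0c -normE. Qed.

Lemma nrmD x y : nrm (x + y) <= nrm x + nrm y.
Proof. by rewrite -lecR rmorphD/= -!normE ler_normD. Qed.

Lemma nrmN x : nrm (- x) = nrm x.
Proof. by rewrite /nrm normrN. Qed.

Lemma nrm0 : nrm 0 = 0.
Proof. by rewrite /nrm normr0. Qed.

Lemma nrm_eq0 x : nrm x = 0 -> x = 0.
Proof. by move=> x0; apply: normr0_eq0; rewrite normE x0. Qed.

Lemma nrmZ (r : R) x : nrm (r%:C *: x) = `|r| * nrm x.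
Proof.
apply: complexI; rewrite -normE normrZ rmorphM/= -normE; congr (_ * _).
by rewrite normc_def/= expr0n/= addr0 sqrtr_sqr.
Qed.

Lemma dotC x y : dot x y = (dot y x)^*.
Proof. by rewrite hermC/= mul1r. Qed.

Lemma rdotC x y : rdot x y = rdot y x.
Proof. by rewrite /rdot dotC; case: (dot y x). Qed.

Lemma rdotDl x y z : rdot (x + y) z = rdot x z + rdot y z.
Proof. by rewrite /rdot linearDl raddfD. Qed.

Lemma rdotNl x z : rdot (- x) z = - rdot x z.
Proof. by rewrite /rdot linearNl raddfN. Qed.

Lemma rdotZl (r : R) x z : rdot (r%:C *: x) z = r * rdot x z.
Proof. by rewrite /rdot linearZl_LR/=; case: (dot x z) => a b /=; ring. Qed.

Lemma rdotDr x y z : rdot z (x + y) = rdot z x + rdot z y.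
Proof. by rewrite rdotC rdotDl !(rdotC z). Qed.

Lemma rdotNr x z : rdot z (- x) = - rdot z x.
Proof. by rewrite rdotC rdotNl rdotC. Qed.

Lemma rdotZr (r : R) x z : rdot z (r%:C *: x) = r * rdot z x.
Proof. by rewrite rdotC rdotZl rdotC. Qed.

Definition rdotE := (rdotDl, rdotDr, rdotNl, rdotNr, rdotZl, rdotZr).

Lemma nrm_sqr x : nrm x ^+ 2 = rdot x x.
Proof. by rewrite /rdot -hdot normE -rmorphXn. Qed.

(** Cauchy-Schwarz comes from squaring the triangle inequality, since the norm is induced by
    [dot]. *)
Lemma rdot_le x y : rdot x y <= nrm x * nrm y.
Proof.
have h : nrm (x + y) ^+ 2 <= (nrm x + nrm y) ^+ 2.
  by rewrite ler_pXn2r ?nnegrE ?addr_ge0 ?nrm_ge0// nrmD.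
move: h; rewrite nrm_sqr !rdotE (rdotC y) -!nrm_sqr.
by move=> h; nra.
Qed.

Lemma rdot_abs_le x y : `|rdot x y| <= nrm x * nrm y.
Proof.
rewrite ler_norml rdot_le andbT lerNl -rdotNl.
by rewrite (le_trans (rdot_le _ _))// nrmN.
Qed.

Lemma dot_inj x y : (forall z, dot x z = dot y z) -> x = y.
Proof.
move=> h; apply/eqP; rewrite -subr_eq0 -(@dnorm_eq0 _ _ dot).
by rewrite linearBl/= h subrr.
Qed.

(** * Completeness along geometric sequences *)

Lemma geometric_small (C r e : R) : 0 <= r < 1 -> 0 < e ->
  exists N, forall n, (N <= n)%N -> C * r ^+ n < e.
Proof.
move=> /andP[r0 r1] e0.
have := @cvg_geometric R C r; rewrite ger0_norm// => /(_ r1) /cvgrPdist_lt/(_ _ e0).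
case=> N _ h; exists N => n Nn; have := h n Nn.
by rewrite /= sub0r normrN => /(le_lt_trans (ler_norm _)).
Qed.

Lemma le_geometric (x y C r : R) : 0 <= r < 1 ->
  (forall n, x <= y + C * r ^+ n) -> x <= y.
Proof.
move=> r01 h; apply/ler_addgt0Pl => e e0.
have [N hN] := geometric_small C r01 e0.
by rewrite (le_trans (h N))// addrC lerD2r ltW// hN.
Qed.

Lemma cvg_nrmP (u : nat -> H) l : u @ \oo --> l <->
  forall e : R, 0 < e -> exists N, forall n, (N <= n)%N -> nrm (l - u n) < e.
Proof.
split=> [/cvgrPdist_lt h e e0|h].
  have [|N _ hN] := h e%:C; first by rewrite ltcR.
  by exists N => n /hN; rewrite /= normE ltcR.
apply/cvgrPdist_lt => e e0.
have e1 : (complex.Re e)%:C = e by rewrite RRe_real// gtr0_real.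
rewrite -e1 ltcR in e0.
have [N hN] := h _ e0; exists N => // n /hN nN.
by rewrite /= normE -[X in _ < X]e1 ltcR.
Qed.

(** Completeness with an explicit rate: later limits are handled by real inequalities through
    [le_geometric], without filters. *)
Lemma geometric_cvg (u : nat -> H) (C r : R) : 0 <= r < 1 ->
  (forall n, nrm (u n.+1 - u n) <= C * r ^+ n) ->
  exists l, forall n, nrm (u n - l) <= C / (1 - r) * r ^+ n.
Proof.
move=> r01 hu; have /andP[r0 r1] := r01.
have C0 : 0 <= C by have := hu 0%N; rewrite expr0 mulr1; apply/le_trans/nrm_ge0.
have r1' : 0 < 1 - r by rewrite subr_gt0.
(* The factor [1 - r ^+ k] is that of the finite geometric sum; with it the induction on [k]
   closes. *)
have part n k : nrm (u (n + k)%N - u n) <= C / (1 - r) * r ^+ n * (1 - r ^+ k).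
  elim: k => [|k IH]; first by rewrite addn0 subrr nrm0 expr0 subrr mulr0.
  rewrite addnS -(subrKA (u (n + k)%N)) (le_trans (nrmD _ _))//.
  rewrite (le_trans (lerD (hu _) IH))// exprD exprS.
  by rewrite le_eqVlt; apply/orP; left; apply/eqP; field; rewrite gt_eqF.
have D0 : 0 <= C / (1 - r) by rewrite divr_ge0// ltW.
have tail n m : (n <= m)%N -> nrm (u m - u n) <= C / (1 - r) * r ^+ n.
  move=> nm; rewrite -(subnKC nm) (le_trans (part _ _))// -[leRHS]mulr1.
  apply: ler_wpM2l; first by rewrite mulr_ge0// exprn_ge0.
  by rewrite lerBlDr lerDl exprn_ge0.
have /cvg_ex[l /cvg_nrmP hl] : cvgn u.
  apply/cauchy_cvgP/cauchy_exP => e e0.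
  have e1 : (complex.Re e)%:C = e by rewrite RRe_real// gtr0_real.
  rewrite -e1 ltcR in e0.
  have [N hN] := geometric_small (C / (1 - r)) r01 e0.
  exists (u N), N => // m /= Nm.
  rewrite -ball_normE /= normE -e1 ltcR -nrmN opprB.
  by rewrite (le_lt_trans (tail _ _ Nm))// hN.
exists l => n; apply/ler_addgt0Pr => e e0.
have [N hN] := hl _ e0.
rewrite -(subrKA (u (maxn n N))) (le_trans (nrmD _ _))// lerD//.
  by rewrite -nrmN opprB tail// leq_maxl.
by rewrite -nrmN opprB ltW// hN// leq_maxr.
Qed.

Lemma closed_geometric (V : set H) (u : nat -> H) l (C r : R) : 0 <= r < 1 ->
  closed V -> (forall n, V (u n)) ->
  (forall n, nrm (u n - l) <= C * r ^+ n) -> V l.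
Proof.
move=> r01 cV Vu hu; apply: (@closed_cvg _ _ \oo _ u V) => //.
  by apply: nearW.
apply/cvg_nrmP => e e0; have [N hN] := geometric_small C r01 e0.
by exists N => n /hN; apply: le_lt_trans; rewrite -nrmN opprB.
Qed.

(** * Linear operators and adjoint pairs *)

Definition pack_linear (f : H -> H) (lf : linear f) : {linear H -> H} :=
  HB.pack f (GRing.isLinear.Build _ _ _ _ _ lf).

Lemma linear_bounded (f : H -> H) : linear f -> continuous f ->
  exists2 C, 0 < C & forall x, nrm (f x) <= C * nrm x.
Proof.
move=> lf /(linear_bounded_continuous (pack_linear lf)) /linear_boundedP.
move=> /pinfty_ex_gt0[M M0 h].
have M1 : (complex.Re M)%:C = M by rewrite RRe_real// gtr0_real.
exists (complex.Re M); first by rewrite -ltcR M1.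
by move=> x; rewrite -lecR rmorphM/= -!normE M1 h.
Qed.

Lemma bounded_op_le (f : H -> H) (C : R) : linear f ->
  (forall x, nrm (f x) <= C * nrm x) -> bounded_op f.
Proof.
move=> lf hf; split=> //.
apply/(linear_bounded_continuous (pack_linear lf))/linear_boundedP.
exists `|C|%:C; split; first by apply/complex_realP; exists `|C|.
move=> M CM x /=; rewrite normE (@le_trans _ _ (C * nrm x)%:C) ?lecR// rmorphM/= -normE.
by rewrite ler_wpM2r// (le_trans _ (ltW CM))// lecR ler_norm.
Qed.

Lemma linD f : linear f -> {morph f : x y / x + y}.
Proof. by move=> lf; exact: (linearD (pack_linear lf)). Qed.

Lemma linB f : linear f -> {morph f : x y / x - y}.
Proof. by move=> lf; exact: (linearB (pack_linear lf)). Qed.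

Lemma linN f : linear f -> {morph f : x / - x}.
Proof. by move=> lf; exact: (linearN (pack_linear lf)). Qed.

Lemma linZ f : linear f -> forall a, {morph f : x / a *: x}.
Proof. by move=> lf; exact: (linearZZ (pack_linear lf)). Qed.

Lemma lin0 f : linear f -> f 0 = 0.
Proof. by move=> lf; exact: (linear0 (pack_linear lf)). Qed.

Lemma linear_idf : linear (fun x => x).
Proof. by []. Qed.

Lemma linear_addf f g : linear f -> linear g -> linear (fun x => f x + g x).
Proof.
by move=> lf lg a x y; rewrite (linD lf) (linD lg) (linZ lf) (linZ lg) scalerDr addrACA.
Qed.

Lemma linear_scalef (c : R[i]) f : linear f -> linear (fun x => c *: f x).
Proof.
by move=> lf a x y; rewrite (linD lf) (linZ lf) scalerDr !scalerA mulrC.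
Qed.

Lemma linear_oppf f : linear f -> linear (fun x => - f x).
Proof. by move=> lf a x y; rewrite (linD lf) (linZ lf) opprD scalerN. Qed.

Lemma linear_subf f g : linear f -> linear g -> linear (fun x => f x - g x).
Proof. by move=> lf lg; apply: linear_addf => //; apply: linear_oppf. Qed.

Definition adj f g := forall x y, dot (f x) y = dot x (g y).
Definition symm f := adj f f.

Lemma adj_sym f g : adj f g -> adj g f.
Proof. by move=> h x y; rewrite dotC -h -dotC. Qed.

Lemma adj_idf : symm (fun x => x).
Proof. by []. Qed.

Lemma adj_addf f g f' g' : adj f f' -> adj g g' ->
  adj (fun x => f x + g x) (fun x => f' x + g' x).
Proof. by move=> hf hg x y; rewrite linearDl linearDr/= hf hg. Qed.

Lemma adj_scalef (c : R[i]) f f' : adj f f' ->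
  adj (fun x => c *: f x) (fun x => c^* *: f' x).
Proof. by move=> hf x y; rewrite linearZl_LR linearZr_LR/= hf conjCK. Qed.

Lemma symm_scalef (c : R) f : symm f -> symm (fun x => c%:C *: f x).
Proof.
move=> hf x y; rewrite linearZl_LR linearZr_LR/= hf; congr (_ * _).
by apply/eqP; rewrite eq_complex/= oppr0 !eqxx.
Qed.

Lemma adj_oppf f f' : adj f f' -> adj (fun x => - f x) (fun x => - f' x).
Proof. by move=> hf x y; rewrite linearNl linearNr/= hf. Qed.

Lemma adj_subf f g f' g' : adj f f' -> adj g g' ->
  adj (fun x => f x - g x) (fun x => f' x - g' x).
Proof. by move=> hf hg; apply: adj_addf => //; apply: adj_oppf. Qed.

Lemma adj_compf f g f' g' : adj f f' -> adj g g' ->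
  adj (fun x => f (g x)) (fun x => g' (f' x)).
Proof. by move=> hf hg x y; rewrite hf hg. Qed.

Lemma bounded_op_nrm f : bounded_op f ->
  exists2 C, 0 < C & forall x, nrm (f x) <= C * nrm x.
Proof. by case=> lf; exact: linear_bounded. Qed.

Lemma adj_rdot f g : adj f g -> forall x y, rdot (f x) y = rdot x (g y).
Proof. by move=> h x y; rewrite /rdot h. Qed.

(** * Symmetric and positive operators *)

Lemma symm_real f : symm f -> forall x, dot (f x) x = (rdot (f x) x)%:C.
Proof.
move=> h x; rewrite /rdot RRe_real//; apply/CrealP.
by rewrite -dotC h.
Qed.

(** The defect [h] is sesquilinear and vanishes on the diagonal, hence is antisymmetric. Replacing
    [x] by [i x] then gives [i h = - i h]. *)
Lemma ge0_symm f : linear f -> (forall x, 0 <= dot (f x) x) -> symm f.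
Proof.
move=> lf f0; pose h x y := dot (f x) y - dot x (f y).
have hxx x : h x x = 0.
  by rewrite /h [dot x _]dotC (CrealP _) ?subrr// ger0_real.
have hD x y z : h (x + y) z = h x z + h y z.
  by rewrite /h (linD lf) !linearDl/=; ring.
have hDr x y z : h z (x + y) = h z x + h z y.
  by rewrite /h (linD lf) !linearDr/=; ring.
have hanti x y : h x y = - h y x.
  apply/eqP; rewrite -addr_eq0; apply/eqP.
  by have := hxx (x + y); rewrite hD !hDr !hxx; rewrite add0r addr0.
have hZ a x y : h (a *: x) y = a * h x y.
  by rewrite /h (linZ lf) !linearZl_LR/=; ring.
have hZr a x y : h x (a *: y) = a^* * h x y.
  by rewrite /h (linZ lf) !linearZr_LR/=; ring.
move=> x y; apply/eqP; rewrite -subr_eq0 -/(h x y); apply/eqP.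
have conji : (('i)%C : R[i])^* = - ('i)%C.
  by apply/eqP; rewrite eq_complex/= oppr0 !eqxx.
have := hanti ('i%C *: x) y.
rewrite hZ hZr (hanti y) conji mulrNN.
move=> /eqP; rewrite -addr_eq0 -mulr2n mulrn_eq0/= mulf_eq0.
by case/orP => /eqP // /(congr1 (@complex.Im R))/= /eqP; rewrite oner_eq0.
Qed.

(* Apply [0 <= <f z, z>] at [z = x - f x / k]. *)
Lemma psd_nrm_sqr f (k : R) : linear f -> symm f -> 0 < k ->
  (forall x, 0 <= rdot (f x) x <= k * nrm x ^+ 2) ->
  forall x, nrm (f x) ^+ 2 <= k * rdot (f x) x.
Proof.
move=> lf sf k0 hf x.
have /andP[+ _] := hf (x + (- k^-1)%:C *: f x).
have /andP[_] := hf (f x).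
rewrite (linD lf) (linZ lf) !rdotE (adj_rdot sf (f x) x) -nrm_sqr.
set a := nrm (f x) ^+ 2; set b := rdot (f x) x; set c := rdot _ _ => h1 h2.
have h3 : k^-1 * k^-1 * c <= k^-1 * a.
  rewrite -mulrA ler_pM2l ?invr_gt0//.
  by rewrite mulrC ler_pdivrMr// mulrC.
have h4 : k^-1 * a <= b by lra.
by rewrite -ler_pdivrMl.
Qed.

Lemma psd_nrm f (k : R) : linear f -> symm f -> 0 < k ->
  (forall x, 0 <= rdot (f x) x <= k * nrm x ^+ 2) ->
  forall x, nrm (f x) <= k * nrm x.
Proof.
move=> lf sf k0 hf x.
rewrite -(@ler_pXn2r _ 2)// ?nnegrE ?mulr_ge0 ?nrm_ge0 ?(ltW k0)//.
rewrite (le_trans (psd_nrm_sqr lf sf k0 hf x))// exprMn expr2 -mulrA ler_pM2l//.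
by case/andP: (hf x).
Qed.

(** Solve [f x = y] by iterating [x + (y - f x) / b']. Each step applies [K = 1 - f / b'] to the
    residual, and [K] has norm at most [1 - c / b' < 1]. *)
Lemma symm_coercive_surj f (c b : R) : linear f -> symm f -> 0 < c ->
  (forall x, c * nrm x ^+ 2 <= rdot (f x) x <= b * nrm x ^+ 2) ->
  forall y, exists x, f x = y.
Proof.
move=> lf sf c0 hf y.
(* Enlarging [b] strictly above [c] makes the contraction factor [k] positive, as [psd_nrm]
   requires. *)
have bb : exists2 b', c < b' & b <= b'.
  by exists (`|b| + c + 1); have := normr_ge0 b; have := ler_norm b; lra.
have [b' cb bb'] := bb; have b0 : 0 < b' by apply: lt_trans cb.
pose K x := x - b'^-1%:C *: f x.
pose k := 1 - c / b'.
have k0 : 0 < k by rewrite subr_gt0 ltr_pdivrMr// mul1r.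
have k1 : k < 1 by rewrite ltrBlDr ltrDl divr_gt0.
have b'0 : b' != 0 by rewrite gt_eqF.
have lK : linear K.
  by apply: linear_subf; [exact: linear_idf|exact: linear_scalef].
have sK : symm K by apply: adj_subf; [exact: adj_idf|exact: symm_scalef].
have hfb x : 0 <= rdot (f x) x <= b' * nrm x ^+ 2.
  have /andP[h1 h2] := hf x; have := sqr_ge0 (nrm x).
  by move=> h3; apply/andP; split; nra.
have hK x : 0 <= rdot (K x) x <= k * nrm x ^+ 2.
  have /andP[_ h2] := hfb x; have /andP[h1 _] := hf x.
  rewrite /K /k !rdotE -nrm_sqr mulrBl mul1r.
  rewrite subr_ge0 lerD2l lerN2 [b'^-1 * _]mulrC ler_pdivrMr//.
  by rewrite [_ ^+ 2 * b']mulrC h2/= mulrAC ler_pM2r ?invr_gt0.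
pose fix u n := if n is n'.+1 then u n' + b'^-1%:C *: (y - f (u n')) else 0.
have res n : nrm (y - f (u n)) <= nrm y * k ^+ n.
  elim: n => [|n IH] /=; first by rewrite (lin0 lf) subr0 expr0 mulr1.
  rewrite (linD lf) (linZ lf) opprD addrA -/(K (y - f (u n))).
  rewrite (le_trans (psd_nrm lK sK k0 hK _))// exprS mulrCA ler_pM2l//.
have [|n|l hl] := @geometric_cvg u (b'^-1 * nrm y) k.
- by rewrite ltW.
- rewrite /= addrAC subrr add0r nrmZ ger0_norm ?invr_ge0 ?(ltW b0)// -mulrA.
  by rewrite ler_pM2l ?invr_gt0.
exists l; apply/eqP; rewrite -subr_eq0; apply/eqP/nrm_eq0/eqP.
rewrite eq_le nrm_ge0 andbT.
apply: (@le_geometric _ _ (b' * (b'^-1 * nrm y / (1 - k)) + nrm y) k).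
  by rewrite ltW.
move=> n; rewrite add0r -nrmN opprB -(subrKA (f (u n))) (le_trans (nrmD _ _))//.
rewrite mulrDl [leRHS]addrC lerD ?res// -(linB lf) -[leRHS]mulrA.
by rewrite (le_trans (psd_nrm lf sf b0 hfb _))// ler_pM2l.
Qed.

Lemma symm_coercive_inv f (c b : R) : linear f -> symm f -> 0 < c ->
  (forall x, c * nrm x ^+ 2 <= rdot (f x) x <= b * nrm x ^+ 2) ->
  exists g, [/\ symm g, cancel g f & cancel f g].
Proof.
move=> lf sf c0 hf.
have hc x : c * nrm x <= nrm (f x).
  have [->|x0] := eqVneq (nrm x) 0; first by rewrite mulr0 nrm_ge0.
  have x1 : 0 < nrm x by rewrite lt_def x0 nrm_ge0.
  rewrite -(ler_pM2r x1) -mulrA -expr2.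
  by have /andP[/le_trans->//] := hf x; exact: rdot_le.
have finj : injective f.
  move=> x y fxy; apply/eqP; rewrite -subr_eq0; apply/eqP/nrm_eq0/eqP.
  rewrite eq_le nrm_ge0 andbT -(pmulr_rle0 _ c0) (le_trans (hc _))//.
  by rewrite (linB lf) fxy subrr nrm0.
have [g gK] := choice (symm_coercive_surj lf sf c0 hf).
have Kg : cancel f g by move=> x; apply: finj; rewrite gK.
by exists g; split=> // x y; rewrite -[x in RHS]gK sf gK.
Qed.

(** The adjoint relation alone forces linearity, so operators obtained by choice need no separate
    check. *)
Lemma adj_linear f g : adj f g -> linear f.
Proof.
move=> fg a x y; apply: dot_inj => z.
by rewrite fg !linearDl !linearZl_LR/= !fg.
Qed.

(** * Hellinger-Toeplitz theorem and orthogonal projection *)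

(* Gliding hump: if |f z_n| > 4^n |z_n|, signs can be chosen so that
   x = sum +- 3^-n f(z_n)/|f(z_n)| has |<x, f z_n>| = |<fs x, z_n>| too large. *)
Lemma adj_bounded f fs : adj f fs -> bounded_op f.
Proof.
move=> fA; have lf := adj_linear fA.
have [[C hC]|nC] := pselect (exists C, forall x, nrm (f x) <= C * nrm x).
  exact: bounded_op_le hC.
have {}nC C : exists x, C * nrm x < nrm (f x).
  apply: contrapT => h; apply: nC; exists C => x.
  by rewrite leNgt; apply/negP => h'; apply: h; exists x.
have [z hz] := choice (fun n => nC (4 ^+ n)).
pose g n := nrm (f (z n)).
have g0 n : 0 < g n by rewrite (le_lt_trans _ (hz n))// mulr_ge0 ?nrm_ge0 ?exprn_ge0.
have gn0 n : g n != 0 by rewrite gt_eqF.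
(* With ratio 1/3 the tail after a term is at most half of that term, so it cannot cancel it. *)
pose q : R := 3^-1.
have q0 : 0 < q by rewrite invr_gt0.
have qn0 : q != 0 by rewrite gt_eqF.
have qE : 1 - q = 2 * q by rewrite /q; field.
have q01 : 0 <= q < 1 by apply/andP; split; [exact: ltW|rewrite invf_lt1// ltr1n].
(* The sign agrees with the inner product already accumulated, so the new term can only increase its
   absolute value. *)
pose s x n : R := if 0 <= rdot x (f (z n)) then 1 else -1.
pose fix u n := if n is n'.+1
  then u n' + (s (u n') n' * q ^+ n / g n')%:C *: f (z n') else 0.
have step n : nrm (u n.+1 - u n) <= q * q ^+ n.
  rewrite /= addrAC subrr add0r nrmZ -/(g n) !normrM normfV (gtr0_norm (g0 n)).
  rewrite mulfVK ?gt_eqF// (gtr0_norm (exprn_gt0 _ q0)) exprS.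
  by rewrite /s; case: ifP; rewrite ?normrN normr1 mul1r.
have [l hl] := geometric_cvg q01 step.
have big n : q ^+ n.+1 * g n <= `|rdot (u n.+1) (f (z n))|.
  rewrite /= rdotDl rdotZl -nrm_sqr -/(g n).
  rewrite (_ : _ / _ * _ = s (u n) n * (q ^+ n.+1 * g n)); last first.
    by field; exact: gn0.
  have := mulr_gt0 (exprn_gt0 n.+1 q0) (g0 n); move: (_ * g n) => A A0.
  rewrite /s; case: ifPn => [r0|]; first by rewrite mul1r ger0_norm// ?addr_ge0 ?lerDr ?(ltW A0).
  rewrite -ltNge => r0; rewrite mulN1r -normrN opprD opprK ger0_norm ?lerDr ?oppr_ge0 ?(ltW r0)//.
  by rewrite addr_ge0 ?oppr_ge0 ?ltW.
(* The ratio here is 3/4, so the right side tends to 0, a contradiction. *)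
have key n : 1 <= 2 * q^-1 * nrm (fs l) * (4^-1 * q^-1) ^+ n.
  have h1 := big n.
  have h2 : `|rdot (u n.+1) (f (z n))| <= q ^+ n.+1 / 2 * g n + nrm (fs l) * nrm (z n).
    rewrite -[u n.+1](subrK l) rdotDl (le_trans (ler_normD _ _))// lerD//.
      rewrite (le_trans (rdot_abs_le _ _))// ler_wpM2r ?nrm_ge0//.
      rewrite (le_trans (hl _))// qE le_eqVlt; apply/orP; left; apply/eqP.
      by field; exact: qn0.
    rewrite rdotC (adj_rdot fA) rdotC.
    by rewrite rdot_abs_le.
  have h3 : nrm (z n) <= 4^-1 ^+ n * g n.
    by rewrite exprVn ler_pdivlMl ?exprn_gt0// ltW// hz.
  have h4 : q ^+ n.+1 * g n <= q ^+ n.+1 / 2 * g n + nrm (fs l) * (4^-1 ^+ n * g n).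
    by rewrite (le_trans h1)// (le_trans h2)// lerD2l ler_wpM2l ?nrm_ge0.
  have h5 : q ^+ n.+1 <= 2 * (nrm (fs l) * 4^-1 ^+ n).
    by rewrite -(ler_pM2r (g0 n)); lra.
  rewrite exprMn [q^-1 ^+ n]exprVn -(ler_pM2l (exprn_gt0 n.+1 q0)) mulr1.
  rewrite (le_trans h5)// le_eqVlt; apply/orP; left; apply/eqP.
  by rewrite exprS; field; rewrite expf_neq0.
have r01 : 0 <= (4^-1 * q^-1 : R) < 1.
  by rewrite /q invrK; apply/andP; split; lra.
have [N /(_ N (leqnn _))] := geometric_small (2 * q^-1 * nrm (fs l)) r01 (@ltr01 R).
by rewrite ltNge key.
Qed.

Lemma dot_eq0_rdot x y : rdot x y = 0 -> rdot x ('i%C *: y) = 0 -> dot x y = 0.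
Proof.
rewrite /rdot linearZr_LR/=; case: (dot x y) => a b /= -> h.
by congr (_ +i* _); move: h; rewrite mul0r mulN1r opprK add0r.
Qed.

(** A minimizing sequence for the distance to [V] converges by the parallelogram law, and the first
    variation at its limit gives orthogonality. *)
Lemma orthogonal_projection (V : set H) : closed V -> V 0 ->
  (forall a x y, V x -> V y -> V (a *: x + y)) ->
  exists P : H -> H, [/\ symm P, forall x, V (P x) & forall x, V x -> P x = x].
Proof.
move=> cV V0 VP.
have VD x y : V x -> V y -> V (x + y) by move=> ? ?; rewrite -[x]scale1r; exact: VP.
have VZ a x : V x -> V (a *: x) by move=> ?; rewrite -[_ *: _]addr0; exact: VP.
have VN x : V x -> V (- x) by move=> ?; rewrite -scaleN1r; exact: VZ.
(* A pointwise choice suffices: orthogonality of [x - P x] to [V] gives symmetry of [P]. *)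
suff /choice[P hP] : forall x, exists v, V v /\ forall w, V w -> dot (x - v) w = 0.
  have PP x y : dot (P x) y = dot (P x) (P y).
    apply/eqP; rewrite -subr_eq0 -linearBr/= dotC (proj2 (hP y)) ?conjC0//.
    exact: (proj1 (hP x)).
  exists P; split=> [x y|x|x Vx].
  - by rewrite PP [RHS]dotC (PP y) -dotC.
  - exact: (proj1 (hP x)).
  - apply/esym/eqP; rewrite -subr_eq0 -(@dnorm_eq0 _ _ dot); apply/eqP.
    by apply: (proj2 (hP x)); apply: VD => //; apply: VN; exact: (proj1 (hP x)).
move=> x; pose E : set R := [set nrm (x - v) ^+ 2 | v in V].
have hE : has_inf E.
  split; first by exists (nrm (x - 0) ^+ 2), 0.
  by exists 0 => _ [v _ <-]; exact: sqr_ge0.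
have Ed v : V v -> inf E <= nrm (x - v) ^+ 2.
  by move=> Vv; apply: ge_inf; [exact: (proj2 hE)|exists v].
pose d := inf E; have d0 : 0 <= d.
  by apply: lb_le_inf; [exact: (proj1 hE)|move=> _ [v _ <-]; exact: sqr_ge0].
pose q : R := 2^-1.
have q0 : 0 < q by rewrite invr_gt0.
have q01 : 0 <= q < 1 by apply/andP; split; [exact: ltW|rewrite invf_lt1// ltr1n].
(* The squared tolerance makes consecutive points geometrically close: the parallelogram law bounds
   their squared distance by [4 q^(2n)]. *)
have /choice[v hv] n : exists v, V v /\ nrm (x - v) ^+ 2 < d + (q ^+ n) ^+ 2.
  have [_ [v Vv <-] h] := inf_adherent (exprn_gt0 2 (exprn_gt0 n q0)) hE.
  by exists v.
have step n : nrm (v n.+1 - v n) <= 2 * q ^+ n.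
  have [V1 h1] := hv n; have [V2 h2] := hv n.+1.
  have h3 := Ed _ (VZ q%:C _ (VD _ _ V1 V2)).
  rewrite -(@ler_pXn2r _ 2)// ?nnegrE ?mulr_ge0 ?nrm_ge0 ?exprn_ge0 ?(ltW q0)//.
  have par : nrm (v n.+1 - v n) ^+ 2 + 4 * nrm (x - q%:C *: (v n + v n.+1)) ^+ 2
      = 2 * nrm (x - v n) ^+ 2 + 2 * nrm (x - v n.+1) ^+ 2.
    rewrite !nrm_sqr !rdotE.
    rewrite (rdotC (v n) x) (rdotC (v n.+1) x) (rdotC (v n.+1) (v n)).
    by rewrite /q; field.
  move: h2; rewrite [q ^+ _]exprS => h2.
  have qq : (q * q ^+ n) ^+ 2 <= (q ^+ n) ^+ 2.
    case/andP: q01 => q0' /ltW q1'.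
    by rewrite exprMn ler_piMl ?sqr_ge0// exprn_ile1.
  by rewrite exprMn; rewrite /d in h1 h2; lra.
have [l hl] := geometric_cvg q01 step.
have Vl : V l by apply: closed_geometric q01 cV _ hl => n; exact: (proj1 (hv n)).
have hld : nrm (x - l) ^+ 2 <= d.
  rewrite -(sqr_sqrtr d0) ler_pXn2r ?nnegrE ?nrm_ge0 ?sqrtr_ge0//.
  apply: (le_geometric (C := 1 + 2 / (1 - q)) q01) => n.
  rewrite -(subrKA (v n)) (le_trans (nrmD _ _))// mulrDl mul1r addrA lerD ?hl//.
  rewrite -(@ler_pXn2r _ 2)// ?nnegrE ?addr_ge0 ?nrm_ge0 ?sqrtr_ge0 ?exprn_ge0 ?(ltW q0)//.
  rewrite (le_trans (ltW (proj2 (hv n))))// sqrrD sqr_sqrtr// lerD2r lerDl.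
  by rewrite mulrn_wge0// mulr_ge0 ?sqrtr_ge0// exprn_ge0// ltW.
have orth w : V w -> rdot (x - l) w = 0.
  move=> Vw; have [w0|w0] := eqVneq (rdot w w) 0.
    rewrite (nrm_eq0 (x := w)) ?/rdot ?linear0r//.
    by apply/eqP; rewrite -sqrf_eq0 nrm_sqr w0.
  have wp : 0 < rdot w w by rewrite lt_def w0 -nrm_sqr sqr_ge0.
  (* This [t] minimizes the distance from [x - l] to [t w]; minimality of [l] forces [t = 0]. *)
  pose t := rdot (x - l) w / rdot w w.
  have := Ed _ (VD _ _ Vl (VZ t%:C _ Vw)).
  move/(le_trans hld); rewrite opprD addrA.
  rewrite !nrm_sqr; move: (x - l) @t => e t.
  rewrite !rdotE (rdotC w e); have : t * rdot w w = rdot e w by rewrite /t divfK.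
  move=> ts h; have : t * (t * rdot w w) <= 0 by rewrite ts in h *; lra.
  rewrite mulrA pmulr_lle0// -expr2 => t0.
  have : t ^+ 2 == 0 by rewrite eq_le t0 sqr_ge0.
  by rewrite sqrf_eq0 => /eqP t1; rewrite -ts t1 mul0r.
exists l; split=> // w Vw; apply: dot_eq0_rdot; apply: orth => //.
exact: VZ.
Qed.

Lemma linear_rangeP f : linear f ->
  forall a x y, range f x -> range f y -> range f (a *: x + y).
Proof.
by move=> lf a _ _ [x _ <-] [y _ <-]; exists (a *: x + y) => //; rewrite (linD lf) (linZ lf).
Qed.

(** * Uniqueness and symmetry of geometric limits *)

Lemma cvg_geometric_unique (u : nat -> H) x y (C D r : R) : 0 <= r < 1 ->
  (forall n, nrm (u n - x) <= C * r ^+ n) ->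
  (forall n, nrm (u n - y) <= D * r ^+ n) -> x = y.
Proof.
move=> r01 ux uy; apply/eqP; rewrite -subr_eq0; apply/eqP/nrm_eq0/eqP.
rewrite eq_le nrm_ge0 andbT; apply: (@le_geometric _ _ (C + D) r) => // n.
rewrite add0r -(subrKA (u n)) (le_trans (nrmD _ _))// mulrDl lerD ?uy//.
by rewrite -nrmN opprB ux.
Qed.

Lemma dot_im x y : complex.Im (dot x y) = rdot x ('i%C *: y).
Proof. by rewrite /rdot linearZr_LR/=; case: (dot x y) => a b /=; ring. Qed.

Lemma nrm_i x : nrm ('i%C *: x) = nrm x.
Proof.
by rewrite /nrm normrZ normc_def/= expr0n/= add0r expr1n sqrtr1 mul1r.
Qed.

Lemma rdot_cvg_eq (v w : nat -> H) v' w' x y (C D r : R) : 0 <= r < 1 ->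
  (forall n, nrm (v n - v') <= C * r ^+ n) ->
  (forall n, nrm (w n - w') <= D * r ^+ n) ->
  (forall n, rdot (v n) y = rdot x (w n)) -> rdot v' y = rdot x w'.
Proof.
move=> r01 hv hw h; apply/eqP; rewrite -subr_eq0 -normr_le0.
apply: (@le_geometric _ _ (C * nrm y + nrm x * D) r) => // n.
rewrite add0r.
have -> : rdot v' y - rdot x w' = rdot (v' - v n) y - rdot x (w' - w n).
  by rewrite !rdotE h; ring.
rewrite (le_trans (ler_normB _ _))// mulrDl lerD//.
  rewrite (le_trans (rdot_abs_le _ _))// mulrAC ler_wpM2r ?nrm_ge0//.
  by rewrite -nrmN opprB hv.
rewrite (le_trans (rdot_abs_le _ _))// -mulrA ler_wpM2l ?nrm_ge0//.
by rewrite -nrmN opprB hw.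
Qed.

(** Real and imaginary parts pass to the limit separately; by [dot_im] the imaginary part is again a
    real inner product, taken against [i y]. *)
Lemma symm_cvg (u : nat -> H -> H) f (C : H -> R) (r : R) : 0 <= r < 1 ->
  (forall n, symm (u n)) ->
  (forall x n, nrm (u n x - f x) <= C x * r ^+ n) -> symm f.
Proof.
move=> r01 su hu x y; apply/eqP; rewrite eq_complex; apply/andP; split; apply/eqP.
  by apply: rdot_cvg_eq r01 (hu x) (hu y) _ => n; rewrite (adj_rdot (su n)).
rewrite !dot_im; apply: (rdot_cvg_eq (w := fun n => 'i%C *: u n y) (D := C y)) r01 (hu x) _ _ => n.
  by rewrite -scalerBr nrm_i hu.
by rewrite -!dot_im su.
Qed.

Lemma is_adjointP f g : adj f g -> is_adjoint dot f g.
Proof. by move=> fg; split=> //; apply: adj_bounded (adj_sym fg). Qed.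

(** * Positive operators with closed range *)

Section ClosedRange.
Variable A : H -> H.
Hypothesis hA : positive_op dot A.
Hypothesis hAcl : closed (range A).

Lemma positive_linear : linear A. Proof. by case: hA => -[]. Qed.
Let lA := positive_linear.

Lemma positive_symm : symm A.
Proof. by case: hA => -[lf _] f0; apply: ge0_symm. Qed.
Let sA := positive_symm.

Lemma positive_rdot x : 0 <= rdot (A x) x.
Proof. by case: hA => _ /(_ x); rewrite lecE => /andP[]. Qed.

Lemma Anorm_sqr x : Anorm dot A x ^+ 2 = rdot (A x) x.
Proof. by rewrite sqr_sqrtr// positive_rdot. Qed.

Lemma Anorm_ge0 x : 0 <= Anorm dot A x.
Proof. exact: sqrtr_ge0. Qed.

Lemma positive_ub : exists2 b, 0 < b & forall x, rdot (A x) x <= b * nrm x ^+ 2.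
Proof.
have [b b0 hb] := bounded_op_nrm (proj1 hA).
exists b => // x; rewrite (le_trans (rdot_le _ _))// expr2 mulrA.
by rewrite ler_wpM2r ?nrm_ge0.
Qed.

Lemma Anorm_eq0 x : Anorm dot A x = 0 -> A x = 0.
Proof.
move=> x0; have [b b0 hb] := positive_ub.
have hb' z : 0 <= rdot (A z) z <= b * nrm z ^+ 2 by rewrite positive_rdot hb.
apply/nrm_eq0/eqP; rewrite -sqrf_eq0 eq_le sqr_ge0 andbT.
by rewrite (le_trans (psd_nrm_sqr lA sA b0 hb' x))// -Anorm_sqr x0 expr0n/= mulr0.
Qed.

(** These three properties characterize the orthogonal projection onto the range of [A]; linearity
    and idempotence follow from them. *)
Definition range_proj (P : H -> H) :=
  [/\ symm P, forall x, range A (P x) & forall x, P (A x) = A x].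

Lemma range_proj_ex : exists P, range_proj P.
Proof.
have [||P [sP h1 h2]] := orthogonal_projection hAcl; last 1 first.
- by exists P; split=> // x; apply: h2; exists x.
- by exists 0 => //; rewrite (lin0 lA).
- exact: linear_rangeP.
Qed.

Variable P : H -> H.
Hypothesis hP : range_proj P.
Let sP : symm P. Proof. by case: hP. Qed.
Let lP : linear P. Proof. exact: adj_linear sP. Qed.
Let PA x : P (A x) = A x. Proof. by case: hP. Qed.
Let RP x : range A (P x). Proof. by case: hP. Qed.

Lemma range_projK x : P (P x) = P x.
Proof. by have [y _ <-] := RP x. Qed.

Lemma positive_projE x : A (P x) = A x.
Proof. by apply: dot_inj => y; rewrite !sA sP PA. Qed.

(** The kernel of the symmetric operator [A] is orthogonal to its range. *)
Lemma range_proj_inj x y : A x = A y -> P x = P y.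
Proof.
move=> Axy; apply/eqP; rewrite -subr_eq0 -(linB lP) -(@dnorm_eq0 _ _ dot).
by rewrite sP range_projK; have [z _ <-] := RP (x - y); rewrite -sA (linB lA) Axy subrr linear0l.
Qed.

Lemma rdot_proj x : rdot (P x) x = nrm (P x) ^+ 2.
Proof. by rewrite nrm_sqr [RHS](adj_rdot sP) range_projK rdotC. Qed.

Lemma nrm_proj x : nrm (P x) <= nrm x.
Proof.
have := rdot_le (P x) x; rewrite rdot_proj expr2.
have [->|n0] := eqVneq (nrm (P x)) 0; first by rewrite nrm_ge0.
by rewrite ler_pM2l// lt_def n0 nrm_ge0.
Qed.

(* The inverse of A on its range is symmetric, hence bounded. *)
Lemma positive_lb : exists2 a, 0 < a & forall x, a * nrm (P x) ^+ 2 <= rdot (A x) x.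
Proof.
have /choice[G0 hG0] x : exists y, A y = P x by have [y _ ?] := RP x; exists y.
(* Projecting picks the only preimage lying in the range of [A], which makes [G] symmetric. *)
pose G x := P (G0 x).
have AG x : A (G x) = P x by rewrite /G positive_projE.
have PG x : P (G x) = G x by rewrite /G range_projK.
have sG : symm G by move=> x y; rewrite -{1}PG sP -[P y]AG -sA AG sP PG.
have GA x : G (A x) = P x by rewrite -PG; apply: range_proj_inj; rewrite AG PA.
have [C C0 hC] := bounded_op_nrm (adj_bounded sG).
have [b b0 hb] := positive_ub.
have hb' z : 0 <= rdot (A z) z <= b * nrm z ^+ 2 by rewrite positive_rdot hb.
(* Combine [|P x| = |G (A x)| <= C |A x|] with [|A x|^2 <= b <A x, x>]. *)
exists (C ^+ 2 * b)^-1 => [|x]; first by rewrite invr_gt0 mulr_gt0 ?exprn_gt0.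
rewrite ler_pdivrMl ?mulr_gt0 ?exprn_gt0// -mulrA.
apply: (@le_trans _ _ (C ^+ 2 * nrm (A x) ^+ 2)).
  by rewrite -exprMn ler_pXn2r ?nnegrE ?mulr_ge0 ?nrm_ge0 ?(ltW C0)// -GA.
by rewrite ler_pM2l ?exprn_gt0//; exact: psd_nrm_sqr hb' x.
Qed.

(* With K = P - A / b one has 0 <= K <= k < 1, and
   Y = (K + Y^2) / 2 means (P - Y)^2 = A / b. *)
Lemma positive_sqrt : exists2 B, is_sqrt dot A B & range B `<=` range A.
Proof.
have [a a0 ha] := positive_lb.
have [b1 b10 hb1] := positive_ub.
(* Adding [a] keeps [b] an upper bound for [A] and gives [a < b], that is, [0 < k]. *)
pose b := b1 + a.
have b0 : 0 < b by rewrite addr_gt0.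
have bn0 : b != 0 by rewrite gt_eqF.
pose k := 1 - a / b.
have k0 : 0 < k by rewrite subr_gt0 ltr_pdivrMr// mul1r ltrDr.
have k1 : k < 1 by rewrite ltrBlDr ltrDl divr_gt0.
have k01 : 0 <= k < 1 by rewrite k1 ltW.
pose K x := P x - b^-1%:C *: A x.
have sK : symm K by apply: adj_subf => //; exact: symm_scalef.
have PK x : P (K x) = K x by rewrite /K (linB lP) range_projK (linZ lP) PA.
have lK := adj_linear sK.
have KE x : rdot (K x) x = nrm (P x) ^+ 2 - rdot (A x) x / b.
  by rewrite /K !rdotE rdot_proj mulrC.
have hK x : 0 <= rdot (K x) x <= k * nrm x ^+ 2.
  rewrite KE; apply/andP; split.
    have -> : rdot (A x) x = rdot (A (P x)) (P x).
      by rewrite positive_projE -(adj_rdot sP) PA.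
    rewrite subr_ge0 ler_pdivrMr// [_ * b]mulrC.
    by rewrite (le_trans (hb1 _))// ler_wpM2r ?sqr_ge0// lerDl ltW.
  apply: (@le_trans _ _ (k * nrm (P x) ^+ 2)).
    by rewrite /k mulrBl mul1r lerD2l lerN2 mulrAC ler_pM2r ?invr_gt0//.
  by rewrite ler_pM2l// ler_pXn2r ?nnegrE ?nrm_ge0// nrm_proj.
have nK := psd_nrm lK sK k0 hK.
have h0 : (2^-1 : R)%:C *+ 2 = 1 by rewrite -rmorphMn/= -[_ *+ 2]mulr_natr mulVf.
pose fix Y n : H -> H :=
  if n is n'.+1 then fun x => 2^-1%:C *: (K x + Y n' (Y n' x)) else fun=> 0.
have sY n : symm (Y n).
  elim: n => [|n IH] /=; first by move=> x y; rewrite linear0l linear0r.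
  by apply: symm_scalef; apply: adj_addf => //; exact: adj_compf.
have lY n := adj_linear (sY n).
have nY n x : nrm (Y n x) <= k * nrm x.
  elim: n x => [|n IH] x /=; first by rewrite nrm0 mulr_ge0 ?nrm_ge0 ?(ltW k0).
  rewrite nrmZ ger0_norm ?invr_ge0// ler_pdivrMl// (le_trans (nrmD _ _))//.
  rewrite mulr_natl mulr2n lerD// (le_trans (IH _))// ler_pM2l//.
  by rewrite (le_trans (IH _))// ler_piMl ?nrm_ge0 ?ltW.
have dY n x : nrm (Y n.+1 x - Y n x) <= k * nrm x * k ^+ n.
  elim: n x => [|n IH] x.
    rewrite /= subr0 addr0 nrmZ ger0_norm ?invr_ge0// expr0 mulr1.
    by rewrite ler_pdivrMl// (le_trans (nK _))// ler_peMl ?mulr_ge0 ?nrm_ge0 ?ler1n ?(ltW k0).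
  (* The difference of squares is split as [Y' (Y' - Y) + (Y' - Y) Y], which needs no commutation.
     Each summand gains a factor [k], and the 1/2 absorbs their number. *)
  have -> : Y n.+2 x - Y n.+1 x =
      2^-1%:C *: (Y n.+1 (Y n.+1 x - Y n x) + (Y n.+1 (Y n x) - Y n (Y n x))).
    rewrite (linB (lY n.+1)) subrKA.
    by rewrite {1}[Y n.+2]/= {2}[Y n.+1]/= -scalerBr opprD addrACA subrr add0r.
  rewrite nrmZ ger0_norm ?invr_ge0// ler_pdivrMl// (le_trans (nrmD _ _))//.
  rewrite mulr_natl mulr2n lerD//.
    by rewrite (le_trans (nY _ _))// exprS mulrCA ler_pM2l//.
  rewrite (le_trans (IH _))// exprS mulrA ler_pM2r ?exprn_gt0// -mulrA ler_pM2l//.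
  by rewrite mulrC nY.
have /choice[Z hZ] x := geometric_cvg k01 (fun n => dY n x).
have sZ : symm Z := symm_cvg k01 sY hZ.
have lZ := adj_linear sZ.
have PY n x : P (Y n x) = Y n x.
  elim: n x => [|n IH] x /=; first by rewrite (lin0 lP).
  by rewrite (linZ lP) (linD lP) PK IH.
have PZ x : P (Z x) = Z x.
  apply: cvg_geometric_unique k01 _ (hZ x) => n.
  by rewrite -{1}PY -(linB lP) (le_trans (nrm_proj _))//; exact: hZ.
have ZP x : Z (P x) = Z x.
  by apply: dot_inj => y; rewrite sZ sP PZ sZ.
have nZ x : nrm (Z x) <= k * nrm x.
  apply: (le_geometric k01) => n; rewrite -[Z x](subrK (Y n x)) addrC.
  by rewrite (le_trans (nrmD _ _))// lerD ?nY// -nrmN opprB; exact: hZ.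
(* Both sides are limits of [Y n.+1 x]; [Y n (Y n x)] is compared with [Z (Z x)] through
   [Y n (Z x)]. *)
have Zfix x : Z x = 2^-1%:C *: (K x + Z (Z x)).
  pose D z := k * nrm z / (1 - k).
  have h1 n : nrm (Y n.+1 x - Z x) <= D x * k ^+ n.
    rewrite (le_trans (hZ x n.+1))// exprS mulrCA -/(D x).
    rewrite ler_piMl ?(ltW k1)// mulr_ge0 ?exprn_ge0 ?(ltW k0)// /D.
    by rewrite divr_ge0 ?mulr_ge0 ?nrm_ge0 ?(ltW k0) ?subr_ge0 ?(ltW k1).
  apply: (cvg_geometric_unique (C := D x) (D := (k * D x + D (Z x)) / 2)
    (u := fun n => Y n.+1 x) k01 h1) => n /=.
  rewrite -scalerBr opprD addrACA subrr add0r nrmZ ger0_norm ?invr_ge0//.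
  rewrite [_ / 2]mulrC -mulrA ler_pM2l ?invr_gt0// mulrDl.
  rewrite -(subrKA (Y n (Z x))) (le_trans (nrmD _ _))// lerD ?hZ//.
  by rewrite -(linB (lY n)) (le_trans (nY _ _))// -mulrA ler_pM2l// hZ.
pose c := (Num.sqrt b)%:C.
pose B x := c *: (P x - Z x).
have sB : symm B by apply: symm_scalef; exact: adj_subf.
exists B; last by move=> _ [x _ <-]; rewrite /B -PZ -(linB lP) -(linZ lP).
split; first split; first exact: adj_bounded sB.
  (* Positivity: [<Z x, x> = <Z P x, P x> <= |P x|^2], because [Z] has norm at most [k < 1]. *)
  move=> x; rewrite (symm_real sB) ler0c /B rdotZl mulr_ge0 ?sqrtr_ge0//.
  rewrite rdotDl rdotNl rdot_proj subr_ge0 -ZP -PZ (adj_rdot sP).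
  rewrite (le_trans (rdot_le _ _))// expr2 ler_wpM2r ?nrm_ge0//.
  by rewrite (le_trans (nZ _))// ler_piMl ?nrm_ge0 ?ltW.
apply/funext => x /=; rewrite /B.
have lPZ : linear (fun x => P x - Z x) by exact: linear_subf.
rewrite (linZ lP) (linZ lZ) -scalerBr scalerA (linB lP) (linB lZ) range_projK PZ ZP.
have -> : P x - Z x - (Z x - Z (Z x)) = b^-1%:C *: A x.
  have : Z x + Z x = K x + Z (Z x).
    by rewrite {1 2}(Zfix x) -scalerDl -mulr2n h0 scale1r.
  rewrite opprB [Z (Z x) - _]addrC addrA -[_ - _ - _]addrA -opprD => ->.
  by rewrite opprD addrA subrK /K opprB addrC subrK.
by rewrite scalerA -rmorphM -expr2 sqr_sqrtr ?ltW// -rmorphM mulfV// scale1r.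
Qed.
End ClosedRange.

(** * A-invertibility *)

Section ANormal.

Variable A : H -> H.
Hypothesis hA : positive_op dot A.
Hypothesis hAcl : closed (range A).
Local Notation Anorm := (Anorm dot A).
Let lA : linear A. Proof. exact: positive_linear hA. Qed.
Let sA : symm A. Proof. exact: positive_symm hA. Qed.

Lemma Anorm_ext x y : A x = A y -> Anorm x = Anorm y.
Proof. by rewrite /Defs.Anorm => Axy; rewrite Axy sA Axy -sA. Qed.

Lemma AnormN x : Anorm (- x) = Anorm x.
Proof. by rewrite /Defs.Anorm (linN lA) linearNl linearNr/= opprK. Qed.

Lemma AnormZ (r : R) x : 0 <= r -> Anorm (r%:C *: x) = r * Anorm x.
Proof.
move=> r0; rewrite /Defs.Anorm (linZ lA) -!/(rdot _ _) rdotZl rdotZr mulrA -expr2.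
by rewrite sqrtrM ?sqr_ge0// sqrtr_sqr ger0_norm.
Qed.

(** The range inclusion makes [f] preserve the kernel of [A], so [x] may be replaced by [P x], whose
    norm is controlled by [|x|_A]. *)
Lemma B_Asqrt_Anorm f : B_Asqrt dot A f ->
  exists2 d, 0 < d & forall x, Anorm (f x) <= d * Anorm x.
Proof.
move=> [bf [B [pB BB] [fs [_ ffs] fsB]]].
have lf := proj1 bf.
have sB := positive_symm pB.
have BBE x : B (B x) = A x by rewrite -BB.
have Af0 x : A x = 0 -> A (f x) = 0.
  move=> Ax0; have Bx0 : B x = 0.
    by apply/eqP; rewrite -(@dnorm_eq0 _ _ dot) -sB BBE Ax0 linear0l.
  rewrite -BBE; have -> : B (f x) = 0; last exact: lin0 (positive_linear pB).
  apply: dot_inj => y; rewrite linear0l sB ffs.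
  by have [|z _ /= <-] := fsB (fs (B y)); [exists y|rewrite -sB Bx0 linear0l].
have [P hP] := range_proj_ex hA hAcl.
have [C C0 hC] := bounded_op_nrm bf.
have [a a0 ha] := positive_lb hA hP.
have [b b0 hb] := positive_ub hA.
have AfP x : A (f x) = A (f (P x)).
  apply/eqP; rewrite -subr_eq0 -(linB lA) -(linB lf) Af0//.
  by rewrite (linB lA) (positive_projE hA hP) subrr.
(* From [|f (P x)|_A^2 <= b C^2 |P x|^2] and [a |P x|^2 <= |x|_A^2]. *)
exists (Num.sqrt (b * C ^+ 2 / a)) => [|x].
  by rewrite sqrtr_gt0 divr_gt0 ?mulr_gt0 ?exprn_gt0.
rewrite (Anorm_ext (AfP x)).
rewrite -(@ler_pXn2r _ 2) ?nnegrE ?mulr_ge0 ?Anorm_ge0 ?sqrtr_ge0//.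
rewrite exprMn !(Anorm_sqr hA) sqr_sqrtr; last first.
  by rewrite divr_ge0 ?mulr_ge0 ?exprn_ge0 ?(ltW a0) ?(ltW b0) ?(ltW C0).
rewrite (le_trans (hb _))//.
have -> : b * C ^+ 2 / a * rdot (A x) x = b * (C ^+ 2 * (a^-1 * rdot (A x) x)) by ring.
rewrite ler_pM2l//.
apply: (@le_trans _ _ (C ^+ 2 * nrm (P x) ^+ 2)).
  by rewrite -exprMn ler_pXn2r ?nnegrE ?mulr_ge0 ?nrm_ge0 ?(ltW C0).
by rewrite ler_pM2l ?exprn_gt0// ler_pdivlMl.
Qed.

(** If every constant fails, normalized counterexamples to the constants [1 / (n + 1)] form an
    approximate null sequence. *)
Lemma Anorm_lb f : linear f ->
  (~ exists x : nat -> H, (forall n, Anorm (x n) = 1) /\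
     (fun n => Anorm (f (x n))) @ \oo --> (0 : R)) ->
  exists2 c, 0 < c & forall x, c * Anorm x <= Anorm (f x).
Proof.
move=> lf nx; apply: contrapT => nc; apply: nx.
have /choice[x hx] n : exists x, Anorm x = 1 /\ Anorm (f x) <= harmonic n.
  have [x hx] : exists x, Anorm (f x) < harmonic n * Anorm x.
    apply: contrapT => h; apply: nc; exists (harmonic n) => [|x]; first exact: harmonic_gt0.
    by rewrite leNgt; apply/negP => h'; apply: h; exists x.
  have x0 : 0 < Anorm x.
    rewrite lt_def Anorm_ge0 andbT; apply/negP => /eqP x0.
    by move: hx; rewrite x0 mulr0 ltNge Anorm_ge0.
  have xi0 : 0 <= (Anorm x)^-1 by rewrite invr_ge0 ltW.
  exists ((Anorm x)^-1%:C *: x); rewrite (linZ lf) !AnormZ// mulVf ?gt_eqF//.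
  by split=> //; rewrite ler_pdivrMl// mulrC ltW.
exists x; split=> [n|]; first exact: (proj1 (hx n)).
apply: (squeeze_cvgr _ (cvg_cst 0) (@cvg_harmonic R)).
by apply: nearW => n; rewrite Anorm_ge0 (proj2 (hx n)).
Qed.

(** Expand both squares: the cross terms match because [<A T x, x> = <A x, S x>] and
    [<A S x, x> = <A x, T x>]. *)
Lemma A_normal_shift (T Ts S : H -> H) (lam : R[i]) : adj T Ts ->
  (forall x, Ts (A x) = A (S x)) ->
  (forall x, Anorm (T x) = Anorm (S x)) ->
  forall x, Anorm (lam *: x - T x) = Anorm (lam^* *: x - S x).
Proof.
move=> TTs TsA TS x.
suff h : rdot (A (lam *: x - T x)) (lam *: x - T x) =
         rdot (A (lam^* *: x - S x)) (lam^* *: x - S x).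
  by rewrite /Defs.Anorm; congr Num.sqrt.
have TS' : dot (A (T x)) (T x) = dot (A (S x)) (S x).
  by rewrite !(symm_real sA) -!(Anorm_sqr hA) TS.
congr complex.Re; rewrite !(linB lA) !(linZ lA) !linearBl !linearBr/=.
rewrite !linearZl_LR !linearZr_LR/= conjCK TS'.
have -> : dot (A (T x)) x = dot (A x) (S x) by rewrite sA TTs TsA -sA.
have -> : dot (A (S x)) x = dot (A x) (T x) by rewrite -TsA (adj_sym TTs).
by rewrite -![_ *: _]/(_ * _); ring.
Qed.

Lemma A_invertible_of_lb (M Ms N : H -> H) (c : R) : A <> (fun=> 0) ->
  adj M Ms -> (forall x, Ms (A x) = A (N x)) ->
  (forall x, Anorm (M x) = Anorm (N x)) -> 0 < c ->
  (forall x, c * Anorm x <= Anorm (M x)) -> A_invertible dot A M.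
Proof.
move=> A0 MMs MsA MN c0 hc.
have lM := adj_linear MMs; have lMs := adj_linear (adj_sym MMs).
have [P hP] := range_proj_ex hA hAcl.
have [sP RP PA] := hP; have lP := adj_linear sP.
have AP := positive_projE hA hP; have PP := range_projK hP.
have [a a0 ha] := positive_lb hA hP.
have AM x : A (M x) = A (M (P x)).
  apply: dot_inj => y.
  by rewrite !sA !MMs MsA -!sA AP.
(* The first summand is coercive only on the range of [A]; [1 - P] supplies the complement. *)
pose Q x := Ms (A (M x)) + (x - P x).
have sQ : symm Q.
  apply: adj_addf; last exact: adj_subf.
  by move=> x y; rewrite (adj_sym MMs) sA MMs.
have lQ := adj_linear sQ.
(* Commutation passes to the inverse [W] and places the values of [S] in the range of [A]. *)
have QP x : P (Q x) = Q (P x).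
  by rewrite /Q (linD lP) (linB lP) PP !subrr !addr0 -AM MsA PA.
have [b _ hb] := bounded_op_nrm (adj_bounded sQ).
(* [c^2 a] is the coercivity constant on the range of [A], and 1 that on its complement. *)
pose k := Num.min (c ^+ 2 * a) 1.
have k0 : 0 < k by rewrite lt_min ltr01 andbT mulr_gt0 ?exprn_gt0.
have hQ x : k * nrm x ^+ 2 <= rdot (Q x) x <= b * nrm x ^+ 2.
  apply/andP; split; last first.
    rewrite (le_trans (rdot_le _ _))// expr2 mulrA.
    by rewrite ler_wpM2r ?nrm_ge0.
  rewrite rdotDl (adj_rdot (adj_sym MMs)) -(Anorm_sqr hA).
  rewrite rdotDl rdotNl (rdot_proj hP) -nrm_sqr.
  have h1 : c ^+ 2 * (a * nrm (P x) ^+ 2) <= Anorm (M x) ^+ 2.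
    apply: (@le_trans _ _ (c ^+ 2 * Anorm x ^+ 2)).
      by rewrite (Anorm_sqr hA) ler_pM2l ?exprn_gt0.
    by rewrite -exprMn ler_pXn2r ?nnegrE ?mulr_ge0 ?Anorm_ge0 ?(ltW c0).
  have h2 : nrm (P x) ^+ 2 <= nrm x ^+ 2.
    by rewrite ler_pXn2r ?nnegrE ?nrm_ge0// (nrm_proj hP).
  have h3 : k <= c ^+ 2 * a by rewrite ge_min lexx.
  have h4 : k <= 1 by rewrite ge_min lexx orbT.
  have h5 := sqr_ge0 (nrm (P x)).
  rewrite mulrA in h1; move: h1 h2 h3 h4 h5.
  move: (c ^+ 2 * a) (nrm (P x) ^+ 2) (nrm x ^+ 2) (Anorm (M x) ^+ 2) => p q r s.
  by move=> *; nra.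
have [W [sW QW WQ]] := symm_coercive_inv lQ sQ k0 hQ.
have lW := adj_linear sW.
have WP y : P (W y) = W (P y) by rewrite -[LHS]WQ -QP QW.
pose S x := W (Ms (A x)).
have PS x : P (S x) = S x by rewrite /S WP MsA PA.
have SM x : A (S (M x)) = A x.
  rewrite /S.
  have -> : Ms (A (M x)) = Q (P x).
    by rewrite /Q PP subrr addr0 -AM.
  by rewrite WQ AP.
have MS x : A (M (S x)) = A x.
  apply/eqP; rewrite -subr_eq0 -(linB lA); apply/eqP.
  (* The lower bound concerns [M], while [A N] is what annihilates [M S x - x]; [MN] exchanges the
     two. *)
  apply: (Anorm_eq0 hA); apply/eqP; rewrite eq_le Anorm_ge0 andbT.
  rewrite -(pmulr_rle0 _ c0) (le_trans (hc _))// MN.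
  rewrite (@Anorm_ext _ 0); first by rewrite /Defs.Anorm linear0r sqrtr0.
  rewrite -MsA (linB lA) (linB lMs) (lin0 lA).
  have : Q (S x) = Ms (A x) by rewrite QW.
  by rewrite /Q PS subrr addr0 => ->; rewrite subrr.
have [B BB RB] := positive_sqrt hA hP.
have BBE x : B (B x) = A x by rewrite -(proj2 BB).
have AB x : range B (A x) by exists (B x).
split.
- split; first exact: adj_bounded MMs.
  exists B => //; exists Ms; first exact: is_adjointP.
  (* [Ms] maps the range of [B], contained in that of [A], into the range of [A = B B], hence into
     that of [B]. *)
  by move=> _ [x _ <-] /=; have [|y _ <-] := RB (B x); [exists x|rewrite MsA; exact: AB].
- move=> M0; apply: A0; apply/funext => x.
  by rewrite -MS M0 (lin0 lA).
exists S.
have sS : adj S (fun y => A (M (W y))).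
  by move=> x y; rewrite /S sW (adj_sym MMs) sA.
split.
- split; first exact: adj_bounded sS.
  exists B => //; exists (fun y => A (M (W y))); first exact: is_adjointP.
  by move=> _ [x _ <-]; exact: AB.
- by move=> S0; apply: A0; apply/funext => x; rewrite -SM S0 (lin0 lA).
- by apply/funext => x; exact: MS.
- by apply/funext => x; exact: SM.
Qed.

End ANormal.

End Hilbert.

(** * Equality of the two spectra *)

Theorem theorem4p4 (R : realType) (H : completeNormedModType R[i])
    (dot : {dot H for Num.conj}) (hdot : hilbert_norm dot)
    (A : H -> H) (hA : positive_op dot A) (hA0 : A <> (fun=> 0))
    (hAcl : closed (range A))
    (T : H -> H) (hT : B_A dot A T) (hTn : A_normal dot A T) :
  sigma_A dot A T = sigma_A_app dot A T.
Proof.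
have [S [_ [Ts [_ TTs] TsA] _] TS] := hTn.
have [[lT _] _] := hT.
have {}TsA x : Ts (A x) = A (S x) by have := congr1 (fun f => f x) TsA.
have lM lam : linear (fun x => lam *: x - T x).
  by apply: linear_subf => //; apply: linear_scalef; exact: linear_idf.
have AnormC lam x : Anorm dot A (T x - lam *: x) = Anorm dot A (lam *: x - T x).
  by rewrite -(AnormN hA) opprB.
apply/seteqP; split=> lam /=; last first.
  (* An A-inverse [V] with bound [d] gives [1 = |x_n|_A = |V M x_n|_A <= d |M x_n|_A] for
     [M = lam - T], so [|M x_n|_A] cannot tend to 0. *)
  move=> [x [x1 x0]] [_ _ [V [bV _ _ VM]]].
  have [d d0 hd] := B_Asqrt_Anorm hdot hA hAcl bV.
  have /cvgrPdist_lt/(_ d^-1) := x0; rewrite invr_gt0 => /(_ d0)[N _ /(_ N (leqnn _))]/=.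
  rewrite sub0r normrN ger0_norm ?Anorm_ge0// AnormC ltNge => /negP; apply.
  rewrite -[_^-1]mulr1 -(x1 N) ler_pdivrMl//.
  rewrite -(Anorm_ext hA (congr1 (fun f => f (x N)) VM)).
  exact: hd.
(* Conversely, without an approximate eigenvector sequence [lam - T] is bounded below in [|.|_A],
   and normality makes it A-invertible. *)
move=> nrho; apply: contrapT => napp; apply: nrho.
have [|c c0 hc] := Anorm_lb hA (lM lam).
  by move=> [x [x1 x0]]; apply: napp; exists x; split=> //; under eq_fun do rewrite AnormC.
apply: (A_invertible_of_lb hdot hA hAcl hA0 (Ms := fun x => lam^* *: x - Ts x)
  (N := fun x => lam^* *: x - S x) _ _ _ c0 hc).
- by apply: adj_subf => //; apply: adj_scalef; exact: adj_idf.
- by move=> x; rewrite TsA (linB (positive_linear hA)) (linZ (positive_linear hA)).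
- by move=> x; apply: (A_normal_shift hA lam TTs TsA TS).
Qed.
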